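(* Let $K$ be a field, $Q$ a finite quiver, $\succ$ a length admissible order on the set $\mathcal B$ of paths of $Q$, $\mathcal T$ a set of paths of length $2$ in $Q$, and $\mathcal N=\mathcal B\setminus\mathrm{tip}(\langle\mathcal T\rangle)$. If $I$ is an ideal of $KQ$ generated by uniform length homogeneous elements, then $\Lambda=KQ/I\in\mathrm{GrAlg}(\mathcal T)$ if and only if $\mathcal N=\mathrm{nontip}(I)$. Moreover, if $\Lambda=KQ/I\in\mathrm{GrAlg}(\mathcal T)$ then, as a subspace of $KQ$ (via the identification of $\Lambda$ with $\mathrm{Span}_K(\mathrm{nontip}(I))$), $\Lambda$ has $K$-basis $\mathcal N$.
   Context: $KQ$ is the path algebra, $\mathcal B$ the set of all finite directed paths in $Q$ (vertices are paths of length $0$), $\ell(p)$ the length of a path; paths are written left to right, so a path $p$ from $v$ to $w$ satisfies $vpw=p$. ''Ideal'' means two-sided ideal and $\langle X\rangle$ is the two-sided ideal generated by $X$. A length admissible order is a well-order $\succ$ on $\mathcal B$ such that for $p,q,r,s,t\in\mathcal B$: $p\succ q$ implies $pr\succ qr$ if both are nonzero; $p\succ q$ implies $sp\succ sq$ if both are nonzero; $p=rqt$ implies $p\succeq q$; and $\ell(p)>\ell(q)$ implies $p\succ q$. For nonzero $x=\sum_{p\in\mathcal B}\alpha_p p\in KQ$, $\mathrm{tip}(x)$ is the $\succ$-largest $p$ with $\alpha_p\neq 0$; for $X\subseteq KQ$, $\mathrm{tip}(X)=\{\mathrm{tip}(x): x\in X, x\ne 0\}$ and $\mathrm{nontip}(X)=\mathcal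 B\setminus\mathrm{tip}(X)$. For any ideal $I$, $KQ=I\oplus\mathrm{Span}_K(\mathrm{nontip}(I))$; $\Lambda=KQ/I$ is identified with the subspace $\mathrm{Span}_K(\mathrm{nontip}(I))$ of $KQ$ by sending the class of $x=i_x+n_x$ ($i_x\in I$, $n_x\in \mathrm{Span}_K(\mathrm{nontip}(I))$) to $n_x$. A nonzero $x$ is uniform if $x=vxw$ for some vertices $v,w$; an element is quadratic if it is a $K$-linear combination of paths of length $2$. An ideal is graded if it is generated by length homogeneous elements. A Gröbner basis of a graded ideal $I$ is a set $\mathcal G\subseteq I$ of length homogeneous uniform elements with $\langle\mathrm{tip}(\mathcal G)\rangle=\langle \mathrm{tip}(I)\rangle$. $KQ/I$ is a strong Koszul algebra (with respect to $I$ and $\succ$) if $I$ has a Gröbner basis with respect to $\succ$ consisting of quadratic elements. Given $\mathcal T$ and $\mathcal N$ (the paths having no subpath in $\mathcal T$): $\mathcal N_2$ is the set of paths of length $2$ in $\mathcal N$; for $t\in\mathcal T$, $\mathcal N_2(t)$ is the set of $n\in\mathcal N_2$ with $t\succ n$ and $n$ having the same start vertex and the same end vertex as $t$. Put $D=\sum_{t\in\mathcal T}|\mathcal N_2(t)|$ and $\mathcal A=K^D$, with points written $X=(x_{t,n})_{t\in\mathcal T,\,n\in\mathcal N_2(t)}$. For $X\in\mathcal A$, $\mathcal G(X)=\{g_t : t\in\mathcal T\}$ with $g_t=t-\sum_{n\in\mathcal N_2(t)}x_{t,n}n$. Finally $\mathrm{GrAlg}(\mathcal T)=\{X\in\mathcal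 A : KQ/\langle \mathcal G(X)\rangle$ is a strong Koszul algebra with respect to $\langle\mathcal G(X)\rangle$ and $\succ\}$. One writes $KQ/I\in\mathrm{GrAlg}(\mathcal T)$ if $I=\langle\mathcal G(X)\rangle$ for some $X\in \mathrm{GrAlg}(\mathcal T)$. *)

(* Defs.v *)
From HB Require Import structures.
From mathcomp Require Import all_boot all_order all_algebra.
From mathcomp Require Export finmap.
From mathcomp Require Export mathcomp_extra boolp classical_sets wochoice.
From mathcomp Require Export monalg.

Set Implicit Arguments.
Unset Strict Implicit.
Unset Printing Implicit Defensive.

Import GRing.Theory.
Local Open Scope classical_set_scope.
Local Open Scope ring_scope.

Record quiver := Quiver {
  vertex : finType;
  arrow : finType;
  asrc : arrow -> vertex;
  atgt : arrow -> vertex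
}.

Section Paths.
Context (Q : quiver).

Fixpoint walk (v : vertex Q) (s : seq (arrow Q)) : bool :=
  if s is a :: s' then (asrc a == v) && walk (atgt a) s' else true.

(* A path is a start vertex with a chain of composable arrows read from left
   to right; the start vertex is kept so that vertices are paths of length 0. *)
Record qpath := QPath {
  qval : vertex Q * seq (arrow Q);
  _ : walk qval.1 qval.2
}.

HB.instance Definition _ := [isSub for qval].

(* Opaque on purpose: unfolding these instances makes conversion on finitely
   supported functions over paths very slow. *)
Fact qpath_hasDecEq : hasDecEq qpath.
Proof. exact: (Equality.copy qpath (inj_type (@val_inj _ _ qpath))). Qed.
HB.instance Definition _ := qpath_hasDecEq.

Fact qpath_hasChoice : hasChoice qpath.
Proof. exact: (PCanHasChoice (@valK _ _ qpath)). Qed.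
HB.instance Definition _ := qpath_hasChoice.

Fact qpath_isCountable : Choice_isCountable qpath.
Proof. exact: (Choice_isCountable.Build _ (pcan_pickleK (@valK _ _ qpath))). Qed.
HB.instance Definition _ := qpath_isCountable.

Definition psrc (p : qpath) : vertex Q := (val p).1.
Definition parrows (p : qpath) : seq (arrow Q) := (val p).2.
Definition ptgt (p : qpath) : vertex Q := last (psrc p) (map (@atgt Q) (parrows p)).
Definition plen (p : qpath) : nat := size (parrows p).

Definition trivial_path (v : vertex Q) : qpath := @QPath (v, [::]) isT.

(* [None] stands for a product of paths that is zero in the path algebra. *)
Definition pcat (p q : qpath) : option qpath :=
  if ptgt p == psrc q then insub (psrc p, parrows p ++ parrows q) else None.

Lemma walk_cat v s1 s2 :
  walk v (s1 ++ s2) = walk v s1 && walk (last v (map (@atgt Q) s1)) s2.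
Proof. by elim: s1 v => //= a s IH v; rewrite IH andbA. Qed.

Lemma walkP (p : qpath) : walk (psrc p) (parrows p).
Proof. exact: (valP p). Qed.

Lemma qpath_inj (p q : qpath) :
  psrc p = psrc q -> parrows p = parrows q -> p = q.
Proof.
by move=> e1 e2; apply: val_inj; apply/eqP; rewrite -pair_eqE /=; apply/andP;
  split; apply/eqP.
Qed.

Variant pcat_spec (p q : qpath) : option qpath -> Type :=
| PcatSome r of ptgt p = psrc q & psrc r = psrc p
    & parrows r = parrows p ++ parrows q & ptgt r = ptgt q :
    pcat_spec p q (Some r)
| PcatNone of ptgt p <> psrc q : pcat_spec p q None.

Lemma pcatP (p q : qpath) : pcat_spec p q (pcat p q).
Proof.
rewrite /pcat; case: eqP => [e|ne]; last exact: PcatNone.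
case: insubP => [r _ er|]; last first.
  by rewrite /= walk_cat walkP -/(ptgt p) e walkP.
have e1 : psrc r = psrc p by rewrite /psrc er.
have e2 : parrows r = parrows p ++ parrows q by rewrite /parrows er.
apply: PcatSome => //.
by rewrite /ptgt e1 e2 map_cat last_cat -/(ptgt p) e.
Qed.

Lemma pcatA (p q r : qpath) :
  obind (pcat p) (pcat q r) = obind (pcat^~ r) (pcat p q).
Proof.
case: (pcatP q r) => [s e1 e2 e3 e4|ne]; case: (pcatP p q) => [t f1 f2 f3 f4|nf] //=.
- case: (pcatP p s) => [u g1 g2 g3 g4|]; last by rewrite e2 f1.
  case: (pcatP t r) => [w h1 h2 h3 h4|]; last by rewrite f4 e1.
  congr Some; apply: qpath_inj; first by rewrite g2 h2 f2.
  by rewrite g3 h3 e3 f3 catA.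
- by case: (pcatP p s) => // u; rewrite e2.
- by case: (pcatP t r) => // u; rewrite f4.
Qed.

Lemma pcat1p (v : vertex Q) (p : qpath) :
  pcat (trivial_path v) p = if v == psrc p then Some p else None.
Proof.
case: pcatP => [r e e1 e2 _|].
  have {}e : v = psrc p := e.
  by rewrite e eqxx; congr Some; apply: qpath_inj; rewrite // e1 -e.
by change (v <> psrc p -> None = if v == psrc p then Some p else None);
  move/eqP/negPf => ->.
Qed.

Lemma pcatp1 (v : vertex Q) (p : qpath) :
  pcat p (trivial_path v) = if v == ptgt p then Some p else None.
Proof.
case: pcatP => [r e e1 e2 _|].
  have {}e : ptgt p = v := e.
  by rewrite e eqxx; congr Some; apply: qpath_inj; rewrite // e2 cats0.
by change (ptgt p <> v -> None = if v == ptgt p then Some p else None);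
  move/eqP/negPf; rewrite eq_sym => ->.
Qed.

Definition path2 := {p : qpath | plen p == 2}.

Definition path2_code (p : path2) : vertex Q * 2.-tuple (arrow Q) :=
  (psrc (val p), @Tuple 2 _ (parrows (val p)) (valP p)).

Definition path2_decode (c : vertex Q * 2.-tuple (arrow Q)) : option path2 :=
  obind insub (insub (c.1, tval c.2)).

Lemma path2_codeK : pcancel path2_code path2_decode.
Proof.
move=> p; rewrite /path2_decode /path2_code /= -surjective_pairing valK /=.
by rewrite valK.
Qed.

HB.instance Definition _ := Countable.on path2.
HB.instance Definition _ : isFinite path2 := PCanIsFinite path2_codeK.

End Paths.

Section Biadditive.
Context (V : zmodType) (f : V -> V -> V).
Context (fDl : left_distributive f +%R) (fDr : right_distributive f +%R).
Context (f0 : left_zero 0 f) (fr0 : right_zero 0 f).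

Lemma biadd_suml (J : Type) (s : seq J) (F : J -> V) y :
  f (\sum_(i <- s) F i) y = \sum_(i <- s) f (F i) y.
Proof. exact: (big_morph (f^~ y) (fun a b => fDl a b y) (f0 y)). Qed.

Lemma biadd_sumr (J : Type) (s : seq J) (F : J -> V) x :
  f x (\sum_(i <- s) F i) = \sum_(i <- s) f x (F i).
Proof. exact: (big_morph (f x) (fun a b => fDr x a b) (fr0 x)). Qed.

Lemma biadd_assoc (J : Type) (s t u : seq J) (X Y Z : J -> V) :
  (forall i j k, f (X i) (f (Y j) (Z k)) = f (f (X i) (Y j)) (Z k)) ->
  f (\sum_(i <- s) X i) (f (\sum_(i <- t) Y i) (\sum_(i <- u) Z i)) =
  f (f (\sum_(i <- s) X i) (\sum_(i <- t) Y i)) (\sum_(i <- u) Z i).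
Proof.
move=> fA; rewrite !biadd_suml; apply: eq_bigr => i _.
rewrite [LHS]biadd_sumr [f (X i) (\sum_(j <- t) Y j)]biadd_sumr biadd_suml.
apply: eq_bigr => j _.
by rewrite !biadd_sumr; apply: eq_bigr => k _; exact: fA.
Qed.

End Biadditive.

(* The path algebra: finitely supported functions on the set of paths. *)
Definition path_algebra (K : fieldType) (Q : quiver) := {malg K[qpath Q]}.

Section PathAlgebra.
Context (K : fieldType) (Q : quiver).
Local Notation KQ := (path_algebra K Q).

HB.instance Definition _ := GRing.Lmodule.on KQ.

Implicit Types (x y z : KQ) (p q r : qpath Q).

Definition pelt p : KQ := << p >>.

Lemma peltE p : pelt p = << p >>.
Proof. by []. Qed.

Definition pcoef x p : K := x@_p.

Definition psupp x : {fset qpath Q} := msupp x.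

Definition pmulU p q : KQ := if pcat p q is Some r then pelt r else 0.

Definition pmul_def x y : KQ :=
  \sum_(p <- psupp x) \sum_(q <- psupp y) (pcoef x p * pcoef y q) *: pmulU p q.

Definition pmul x y : KQ := pmul_def x y.

Lemma pmulE x y : pmul x y = pmul_def x y.
Proof. by []. Qed.

Definition pone : KQ := \sum_(v : vertex Q) pelt (trivial_path v).

(* Conversion must not unfold these to operations on finite maps; reason with
   [peltE], [pmulE] and the lemmas of [monalg] instead. *)
#[global] Opaque fgzero fgadd fgopp fgscale mkmalgU pelt pmul.

Lemma pcoef_pelt p q : pcoef (pelt p) q = (p == q)%:R.
Proof. by rewrite /pcoef peltE mcoeffU. Qed.

Lemma psupp_pelt p : psupp (pelt p) = [fset p]%fset.
Proof. by rewrite /psupp peltE msuppU oner_eq0. Qed.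

Lemma psuppP x p : (p \in psupp x) = (pcoef x p != 0).
Proof. by rewrite /pcoef mcoeff_neq0. Qed.

Lemma pcoefD x y p : pcoef (x + y) p = pcoef x p + pcoef y p.
Proof. exact: mcoeffD. Qed.

Lemma pcoefZ c x p : pcoef (c *: x) p = c * pcoef x p.
Proof. exact: mcoeffZ. Qed.

Lemma kq_eqP x y : (forall p, pcoef x p = pcoef y p) -> x = y.
Proof. by move=> h; apply/malgP. Qed.

Lemma kqE x : x = \sum_(p <- psupp x) pcoef x p *: pelt p.
Proof.
rewrite [LHS]monalgE; apply: eq_bigr => p _; rewrite peltE.
by apply/malgP => k; rewrite mcoeffZ !mcoeffU mulr_natr.
Qed.

Lemma pmulw (d1 d2 : {fset qpath Q}) x y :
  (psupp x `<=` d1)%fset -> (psupp y `<=` d2)%fset ->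
  pmul x y =
  \sum_(p <- d1) \sum_(q <- d2) (pcoef x p * pcoef y q) *: pmulU p q.
Proof.
move=> le1 le2; rewrite pmulE /pmul_def (big_fset_incl _ le1) /=.
  apply/eq_bigr => p _; apply/big_fset_incl => // q _.
  by rewrite psuppP negbK => /eqP ->; rewrite mulr0 scale0r.
move=> p _; rewrite psuppP negbK => /eqP xp; rewrite big1 // => q _.
by rewrite xp mul0r scale0r.
Qed.

Lemma pmulDl : left_distributive pmul +%R.
Proof.
move=> x y z.
rewrite (pmulw (msuppD_le x y) (fsubset_refl (psupp z))).
rewrite (pmulw (fsubsetUl (psupp x) (psupp y)) (fsubset_refl (psupp z))).
rewrite (pmulw (fsubsetUr (psupp x) (psupp y)) (fsubset_refl (psupp z))).
rewrite -big_split /=; apply/eq_bigr => p _.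
rewrite -big_split /=; apply/eq_bigr => q _.
by rewrite pcoefD mulrDl scalerDl.
Qed.

Lemma pmulDr : right_distributive pmul +%R.
Proof.
move=> x y z.
rewrite (pmulw (fsubset_refl (psupp x)) (msuppD_le y z)).
rewrite (pmulw (fsubset_refl (psupp x)) (fsubsetUl (psupp y) (psupp z))).
rewrite (pmulw (fsubset_refl (psupp x)) (fsubsetUr (psupp y) (psupp z))).
rewrite -big_split /=; apply/eq_bigr => p _.
rewrite -big_split /=; apply/eq_bigr => q _.
by rewrite pcoefD mulrDr scalerDl.
Qed.

Lemma pmul0 : left_zero 0 pmul.
Proof. by move=> x; rewrite pmulE /pmul_def /psupp msupp0 big_seq_fset0. Qed.

Lemma pmulr0 : right_zero 0 pmul.
Proof.
move=> x; rewrite pmulE /pmul_def big1 // => p _.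
by rewrite /psupp msupp0 big_seq_fset0.
Qed.

Lemma pmulZl c x y : pmul (c *: x) y = c *: pmul x y.
Proof.
rewrite (pmulw (msuppZ_le c x) (fsubset_refl (psupp y))) pmulE /pmul_def.
rewrite scaler_sumr; apply: eq_bigr => p _.
rewrite scaler_sumr; apply: eq_bigr => q _.
by rewrite pcoefZ scalerA mulrA.
Qed.

Lemma pmulZr c x y : pmul x (c *: y) = c *: pmul x y.
Proof.
rewrite (pmulw (fsubset_refl (psupp x)) (msuppZ_le c y)) pmulE /pmul_def.
rewrite scaler_sumr; apply: eq_bigr => p _.
rewrite scaler_sumr; apply: eq_bigr => q _.
by rewrite pcoefZ scalerA mulrCA.
Qed.

Lemma pmulUU p q : pmul (pelt p) (pelt q) = pmulU p q.
Proof.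
rewrite pmulE /pmul_def !psupp_pelt !big_seq_fset1 !pcoef_pelt !eqxx.
by rewrite mulr1 scale1r.
Qed.

Lemma pmulA : associative pmul.
Proof.
move=> x y z; rewrite (kqE x) (kqE y) (kqE z).
apply: (biadd_assoc pmulDl pmulDr pmul0 pmulr0) => p q r.
rewrite !pmulZl !pmulZr !pmulZl.
rewrite [in RHS](scalerA (pcoef z r)) [in RHS]mulrC -[in RHS]scalerA.
apply: (congr1 (fun u => _ *: (_ *: (_ *: u)))).
rewrite !pmulUU /pmulU; have := pcatA p q r.
case: (pcat q r) => [s|]; case: (pcat p q) => [t|] //= e.
- by rewrite !pmulUU /pmulU e.
- by rewrite pmul0 pmulUU /pmulU e.
- by rewrite pmulr0 pmulUU /pmulU -e.
- by rewrite pmul0 pmulr0.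
Qed.

Lemma pmul1 : left_id pone pmul.
Proof.
move=> x; rewrite {2}(kqE x) {1}(kqE x) (biadd_sumr pmulDr pmulr0).
apply: eq_bigr => p _; rewrite pmulZr; congr (_ *: _).
rewrite /pone (biadd_suml pmulDl pmul0) (bigD1 (psrc p)) //=.
rewrite big1 => [|v vp]; rewrite pmulUU /pmulU pcat1p.
  by rewrite eqxx addr0.
by rewrite (negPf vp).
Qed.

Lemma pmulr1 : right_id pone pmul.
Proof.
move=> x; rewrite {2}(kqE x) {1}(kqE x) (biadd_suml pmulDl pmul0).
apply: eq_bigr => p _; rewrite pmulZl; congr (_ *: _).
rewrite /pone (biadd_sumr pmulDr pmulr0) (bigD1 (ptgt p)) //=.
rewrite big1 => [|v vp]; rewrite pmulUU /pmulU pcatp1.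
  by rewrite eqxx addr0.
by rewrite (negPf vp).
Qed.

(* Without vertices the path algebra is the zero ring, hence [PzRing]. *)
HB.instance Definition _ := GRing.Zmodule_isPzRing.Build KQ
  pmulA pmul1 pmulr1 pmulDl pmulDr.

(* [lalgType] requires a nontrivial ring, so bilinearity is left as lemmas. *)
Lemma kq_scalerAl c x y : c *: (x * y) = (c *: x) * y.
Proof. exact: esym (pmulZl c x y). Qed.

Lemma kq_scalerAr c x y : c *: (x * y) = x * (c *: y).
Proof. exact: esym (pmulZr c x y). Qed.

Lemma pelt_mul p q :
  pelt p * pelt q = if pcat p q is Some r then pelt r else 0.
Proof. exact: pmulUU. Qed.

End PathAlgebra.

Arguments pelt K {Q} p.

Definition two_sided_ideal (A : pzRingType) (I : set A) : Prop :=
  [/\ I 0, (forall x y, I x -> I y -> I (x + y)),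
      (forall a x, I x -> I (a * x)) & (forall a x, I x -> I (x * a))].

Definition ideal_gen (A : pzRingType) (X : set A) : set A :=
  smallest (@two_sided_ideal A) X.

Section LinearAlgebra.
Context (K : fieldType) (V : lmodType K).

Definition lin_span (B : set V) : set V :=
  [set x | exists (s : seq V) (c : V -> K),
    (forall b, b \in s -> B b) /\ x = \sum_(b <- s) c b *: b].

Definition lin_indep (B : set V) : Prop :=
  forall (s : seq V) (c : V -> K), uniq s -> (forall b, b \in s -> B b) ->
    \sum_(b <- s) c b *: b = 0 -> forall b, b \in s -> c b = 0.

Definition is_basis (B W : set V) : Prop := lin_indep B /\ lin_span B = W.

End LinearAlgebra.

(* [le p q] reads q \succeq p. *)
Section Order.
Context (Q : quiver) (le : rel (qpath Q)).

Definition path_gt (p q : qpath Q) : bool := (q != p) && le q p.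

Record length_admissible : Prop := LengthAdmissible {
  la_wo : well_order le;
  la_mulr : forall p q r pr qr, pcat p r = Some pr -> pcat q r = Some qr ->
    path_gt p q -> path_gt pr qr;
  la_mull : forall p q s sp sq, pcat s p = Some sp -> pcat s q = Some sq ->
    path_gt p q -> path_gt sp sq;
  la_sub : forall p q r t rq, pcat r q = Some rq -> pcat rq t = Some p ->
    le q p;
  la_len : forall p q, (plen q < plen p)%N -> path_gt p q
}.

End Order.

Section Tips.
Context (K : fieldType) (Q : quiver) (le : rel (qpath Q)).
Local Notation KQ := (path_algebra K Q).

Definition is_tip (x : KQ) (p : qpath Q) : Prop :=
  p \in psupp x /\ forall q, q \in psupp x -> le q p.

Definition tips (X : set KQ) : set (qpath Q) :=
  [set p | exists x, [/\ X x, x != 0 & is_tip x p]].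

Definition nontips (X : set KQ) : set (qpath Q) := ~` tips X.

Definition uniform (x : KQ) : Prop :=
  x != 0 /\ exists v w : vertex Q,
    x = pelt K (trivial_path v) * x * pelt K (trivial_path w).

Definition homogeneous_of (d : nat) (x : KQ) : Prop :=
  forall p, p \in psupp x -> plen p = d.

Definition length_homogeneous (x : KQ) : Prop := exists d, homogeneous_of d x.

Definition quadratic (x : KQ) : Prop := homogeneous_of 2 x.

Definition graded_ideal (I : set KQ) : Prop :=
  exists2 S : set KQ, S `<=` length_homogeneous & I = ideal_gen S.

Definition path_ideal (P : set (qpath Q)) : set KQ := ideal_gen (pelt K @` P).

Definition groebner_basis (I G : set KQ) : Prop :=
  [/\ graded_ideal I, G `<=` I, G `<=` length_homogeneous `&` uniform
    & path_ideal (tips G) = path_ideal (tips I)].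

Definition strong_koszul (I : set KQ) : Prop :=
  exists2 G : set KQ, groebner_basis I G & G `<=` quadratic.

(* KQ/I as a set of cosets, and its embedding in KQ: a coset goes to its
   representative in the span of the nontips, which is unique when I is an
   ideal and [le] is admissible. *)
Definition ideal_coset (I : set KQ) (x : KQ) : set KQ := [set y | I (y - x)].

Definition quotient_by (I : set KQ) : set (set KQ) := range (ideal_coset I).

Definition nontip_span (I : set KQ) : set KQ :=
  lin_span (pelt K @` nontips I).

Definition normal_rep (I : set KQ) (C : set KQ) : KQ :=
  xget 0 (C `&` nontip_span I).

Definition quotient_in_KQ (I : set KQ) : set KQ :=
  normal_rep I @` quotient_by I.

End Tips.

Arguments path_ideal K {Q} P.

Section GrAlg.
Context (K : fieldType) (Q : quiver) (le : rel (qpath Q)) (T : {set path2 Q}).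
Local Notation KQ := (path_algebra K Q).

Definition T_paths : set (qpath Q) := [set val t | t in [set` T]].

Definition N_paths : set (qpath Q) := ~` tips le (path_ideal K T_paths).

Definition N2 : {set path2 Q} := [set n : path2 Q | `[< N_paths (val n) >]].

Definition N2_of (t : path2 Q) : {set path2 Q} :=
  [set n : path2 Q in N2 | [&& path_gt le (val t) (val n), psrc (val n) == psrc (val t)
                   & ptgt (val n) == ptgt (val t)]].

(* The index set of the coordinates x_{t,n}; it has D elements
   (see [card_coordinate]). *)
Definition coordinate := {tn : path2 Q * path2 Q | (tn.1 \in T) && (tn.2 \in N2_of tn.1)}.

Lemma card_coordinate : #|{: coordinate}| = (\sum_(t in T) #|N2_of t|)%N.
Proof.
rewrite card_sig -sum1_card; transitivity
  (\sum_(t in T) \sum_(n in N2_of t) 1)%N; last first.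
  by apply: eq_bigr => t _; rewrite sum1_card.
by rewrite pair_big_dep /=; apply: eq_bigl => -[].
Qed.

Definition affine_space := {ffun coordinate -> K}.

Definition g_of (X : affine_space) (t : path2 Q) : KQ :=
  pelt K (val t) - \sum_(c : coordinate | (val c).1 == t) X c *: pelt K (val (val c).2).

Definition G_of (X : affine_space) : set KQ := [set g_of X t | t in [set` T]].

Definition GrAlg : set affine_space :=
  [set X | strong_koszul le (ideal_gen (G_of X))].

Definition in_GrAlg (I : set KQ) : Prop :=
  exists2 X : affine_space, GrAlg X & I = ideal_gen (G_of X).

End GrAlg.

(* Main.v *)
Require Import Defs.
From mathcomp Require Import all_boot all_order all_algebra.
From mathcomp Require Import zify.

Set Implicit Arguments.
Unset Strict Implicit.
Unset Printing Implicit Defensive.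

Import GRing.Theory.
Local Open Scope classical_set_scope.
Local Open Scope ring_scope.

(** The tips of a monomial ideal are the paths having a subpath among its
    generators ([tips_path_ideal]), so the condition N = nontip(I) says that
    tip(I) consists of the paths with a subpath in T.

    Suppose I is generated by the g_t and has a quadratic Groebner basis G.  Then
    tip(I) is the set of paths with a subpath in tip(G), so it suffices to place
    tip(G), which lies in degree 2, between T and tip(I).  The degree 2 part of
    I is the linear span of the g_t, because the g_t are uniform and quadratic;
    as t is the tip of g_t and does not occur in any other g_t', the tip of a
    linear combination of the g_t is some t in T ([quadratic_tip_in_T]).

    Conversely, suppose tip(I) is the set of paths with a subpath in T.  Every
    path p is congruent modulo I to a combination n of nontips, and since I is
    homogeneous for length and for both end vertices, the division algorithm
    only uses paths parallel to p, of the same length as p, and at most p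
    ([exists_normal_form]).  For p = t in T this makes t - n one of the possible
    g_t, with coefficients that define a point X such that G(X) is contained in
    I.  The ideal generated by G(X) has at least the tips with a subpath in T,
    so all tips of I, and two nested ideals with the same tips are equal
    ([ideal_eq_tips]).

    The basis statement holds because each coset of I meets the span of the
    nontips in exactly one point ([quotient_in_KQE]). *)

(** * Subpaths and parallel paths *)

Section PathFactors.
Context (Q : quiver).
Implicit Types (a b p q r : qpath Q).

(** Two-sided multiplication is treated at once: the one-sided versions are the
    case where the other factor is a vertex, and a two-sided ideal is stable
    under it. *)
Definition pcat3 a q b : option (qpath Q) := obind (fun r => pcat r b) (pcat a q).

Lemma pcat3P a q b p :
  pcat3 a q b = Some p <->
  [/\ ptgt a = psrc q, ptgt q = psrc b, psrc p = psrc a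
    & parrows p = parrows a ++ parrows q ++ parrows b].
Proof.
rewrite /pcat3; case: (pcatP a q) => [r e1 e2 e3 e4|ne] /=; last first.
  by split=> // -[].
case: (pcatP r b) => [s f1 f2 f3 f4|ne]; last first.
  by split=> // -[_ e]; rewrite -e4 in e.
split=> [[<-]|[_ _ gs ga]].
  by split; rewrite ?f2 ?f3 ?e3 ?catA // -e4.
by congr Some; apply: qpath_inj; rewrite ?gs ?f2 // ga f3 e3 catA.
Qed.

Lemma pcat3_tgt a q b p : pcat3 a q b = Some p -> ptgt p = ptgt b.
Proof.
rewrite /pcat3; case: (pcatP a q) => [r _ _ _ _|//] /=.
by case: (pcatP r b) => [s _ _ _ f|//] [<-].
Qed.

Lemma pcat3_len a q b p :
  pcat3 a q b = Some p -> plen p = (plen a + (plen q + plen b))%N.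
Proof. by case/pcat3P => _ _ _ e; rewrite /plen e !size_cat. Qed.

Lemma pcat3_def a q b :
  ptgt a = psrc q -> ptgt q = psrc b -> exists p, pcat3 a q b = Some p.
Proof.
move=> e1 e2; rewrite /pcat3; case: (pcatP a q) => [r _ _ _ f|//] /=.
case: (pcatP r b) => [s _ _ _ _|]; first by exists s.
by rewrite f.
Qed.

Lemma pcat3_inj a b p q r :
  pcat3 a p b = Some r -> pcat3 a q b = Some r -> p = q.
Proof.
move=> /[dup] /pcat3_len lp /pcat3P[ep _ _ er].
move=> /[dup] /pcat3_len lq /pcat3P[eq _ _ er'].
apply: qpath_inj; first by rewrite -ep -eq.
have/eqP := etrans (esym er) er'; rewrite eqseq_cat // eqxx /= eqseq_cat.
  by case/andP => /eqP.
exact: addIn (addnI (etrans (esym lp) lq)).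
Qed.

Lemma pcat3_id p : pcat3 (trivial_path (psrc p)) p (trivial_path (ptgt p)) = Some p.
Proof. by apply/pcat3P; rewrite /= cats0. Qed.

Lemma pcat3_trans a q b p c d r :
  pcat3 a q b = Some p -> pcat3 c p d = Some r ->
  exists a' b', pcat3 a' q b' = Some r.
Proof.
move=> /[dup] /pcat3_tgt tp /pcat3P[e1 e2 e3 e4] /pcat3P[f1 f2 f3 f4].
case: (pcatP c a) => [a' _ ga ga' gt|]; last by rewrite f1 e3.
case: (pcatP b d) => [b' _ gb gb' _|]; last by rewrite -tp f2.
exists a', b'; apply/pcat3P; split; rewrite ?gt ?gb ?ga //.
by rewrite f4 e4 ga' gb' !catA.
Qed.

(** Multidegree of a path: the path algebra is graded by length and by the two
    end vertices, and an ideal generated by uniform length homogeneous elements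
    is homogeneous for this finer grading. *)
Definition parallel p q := [/\ plen p = plen q, psrc p = psrc q & ptgt p = ptgt q].

Lemma parallel_refl p : parallel p p. Proof. by []. Qed.

Lemma parallel_sym p q : parallel p q -> parallel q p.
Proof. by rewrite /parallel => -[-> -> ->]. Qed.

Lemma parallel_trans p q r : parallel p q -> parallel q r -> parallel p r.
Proof. by rewrite /parallel => -[-> -> ->]. Qed.

(** Multidegrees add up: whether a product of paths vanishes, and its
    multidegree, depend only on the multidegrees of the factors. *)
Lemma pcat3_parallel a b p q r :
  parallel p q -> pcat3 a p b = Some r ->
  exists2 s, pcat3 a q b = Some s & parallel r s.
Proof.
move=> [el es et] pr; have /pcat3P[e1 e2 e3 _] := pr.
have [s ps] : exists s, pcat3 a q b = Some s.
  by apply: pcat3_def; rewrite -?es -?et.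
exists s => //; have /pcat3P[_ _ f3 _] := ps; split; rewrite ?e3 //.
  by rewrite (pcat3_len pr) (pcat3_len ps) el.
by rewrite (pcat3_tgt pr) (pcat3_tgt ps).
Qed.

Definition extensions (P : set (qpath Q)) : set (qpath Q) :=
  [set p | exists q a b, P q /\ pcat3 a q b = Some p].

Lemma sub_extensions P : P `<=` extensions P.
Proof. by move=> p Pp; do 3!eexists; split; [exact: Pp | exact: pcat3_id]. Qed.

Lemma extensions_sub P P' : P `<=` P' -> extensions P `<=` extensions P'.
Proof. by move=> sPP' p [q [a [b [/sPP' ? ?]]]]; exists q, a, b. Qed.

Lemma pcat3_extensions P a q b p :
  extensions P q -> pcat3 a q b = Some p -> extensions P p.
Proof.
move=> [r [c [d [Pr rq]]]] qp; have [a' [b' rp]] := pcat3_trans rq qp.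
by exists r, a', b'.
Qed.

End PathFactors.

(** * Length admissible orders *)

Section AdmissibleOrder.
Context (Q : quiver) (le : rel (qpath Q)) (le_adm : length_admissible le).
Implicit Types (p q r : qpath Q).

Lemma le_min (A : {pred qpath Q}) x :
  x \in A -> exists2 z, z \in A & forall y, y \in A -> le z y.
Proof.
move=> Ax; have /(la_wo le_adm)[z [[Az lez] _]] : nonempty A by exists x.
by exists z.
Qed.

Lemma le_total p q : le p q \/ le q p.
Proof.
have [z] := @le_min (pred2 p q) p (predU1l _ erefl).
by case/pred2P=> -> zle; [left|right]; apply: zle; rewrite inE eqxx ?orbT.
Qed.

Lemma le_refl p : le p p.
Proof. by case: (le_total p p). Qed.

Lemma le_anti p q : le p q -> le q p -> p = q.
Proof.
move=> pq qp; have [|z [_ uz]] := la_wo le_adm (A := pred2 p q).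
  by exists p; rewrite inE eqxx.
have uz' w : w \in pred2 p q -> le w p -> le w q -> z = w.
  by move=> pqw wp wq; apply: uz; split=> // r /pred2P[] ->.
by transitivity z; [symmetry|]; apply: uz'; rewrite ?le_refl ?inE ?eqxx ?orbT.
Qed.

Lemma le_trans p q r : le p q -> le q r -> le p r.
Proof.
move=> pq qr; have [z] := @le_min (pred3 p q r) p (predU1l _ erefl).
have p3 : p \in pred3 p q r by rewrite !inE eqxx.
have q3 : q \in pred3 p q r by rewrite !inE eqxx orbT.
have r3 : r \in pred3 p q r by rewrite !inE eqxx !orbT.
case/or3P=> /eqP -> zle; first exact: zle.
  by rewrite (le_anti pq (zle p p3)); apply: zle.
by rewrite -(le_anti qr (zle q q3)).
Qed.

Lemma path_gt_le p q : path_gt le p q -> le q p.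
Proof. by case/andP. Qed.

(** Well-founded induction: a minimal counterexample exists by well-ordering. *)
Lemma path_gt_ind (P : qpath Q -> Prop) :
  (forall p, (forall q, path_gt le p q -> P q) -> P p) -> forall p, P p.
Proof.
move=> ih p; apply: contrapT => nPp.
have [|z] := @le_min [pred q | ~~ `[< P q >]] p; first exact/asboolPn.
move=> /asboolPn nPz zmin; apply: nPz; apply: ih => q /andP[nzq qz].
apply: contrapT => /asboolPn /zmin zq; case/eqP: nzq.
by apply: le_anti.
Qed.

Lemma le_max (s : seq (qpath Q)) x :
  x \in s -> exists2 z, z \in s & forall y, y \in s -> le y z.
Proof.
case: s => // y s _; elim: s y => [|z s ih] y.
  by exists y => [|w]; rewrite inE // => /eqP ->; apply: le_refl.
have [m ms mle] := ih z; have [ym|my] := le_total y m.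
  exists m; first by rewrite inE ms orbT.
  by move=> w; rewrite inE => /predU1P[->//|]; apply: mle.
exists y; first exact: mem_head.
move=> w; rewrite inE => /predU1P[->|/mle wm]; first exact: le_refl.
exact: le_trans wm my.
Qed.

Lemma pcat3_gt a b p q p' q' :
  pcat3 a p b = Some p' -> pcat3 a q b = Some q' ->
  path_gt le p q -> path_gt le p' q'.
Proof.
rewrite /pcat3; case ep: (pcat a p) => [r|//]; case eq: (pcat a q) => [s|//] /=.
by move=> rp sq /(la_mull le_adm ep eq) /(la_mulr le_adm rp sq).
Qed.

End AdmissibleOrder.

(** * Coefficients and supports in the path algebra *)

Section Coefficients.
Context (K : fieldType) (Q : quiver).
Local Notation KQ := (path_algebra K Q).
Implicit Types (x y : KQ) (a b p q r : qpath Q) (P : set (qpath Q)).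

Lemma pcoef0 p : pcoef (0 : KQ) p = 0.
Proof. by rewrite -(scale0r (0 : KQ)) pcoefZ mul0r. Qed.

Lemma pcoefN x p : pcoef (- x) p = - pcoef x p.
Proof. by rewrite -scaleN1r pcoefZ mulN1r. Qed.

Lemma pcoef_sum (J : Type) (s : seq J) (R : pred J) (F : J -> KQ) p :
  pcoef (\sum_(i <- s | R i) F i) p = \sum_(i <- s | R i) pcoef (F i) p.
Proof. by apply: (big_morph (fun x => pcoef x p)) => [x y|]; rewrite ?pcoefD ?pcoef0. Qed.

Lemma pcoef_out x p : p \notin psupp x -> pcoef x p = 0.
Proof. by rewrite psuppP negbK => /eqP. Qed.

Lemma sum_pelt x (R : pred (qpath Q)) p :
  pcoef (\sum_(q <- psupp x | R q) pcoef x q *: pelt K q) p =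
  if R p then pcoef x p else 0.
Proof.
rewrite pcoef_sum -big_filter; under eq_bigr do rewrite pcoefZ pcoef_pelt.
case: (boolP (p \in [seq i <- psupp x | R i])) => [pin|pout].
  rewrite (bigD1_seq p) ?filter_uniq ?fset_uniq //= eqxx mulr1 big1 ?addr0.
    by move: pin; rewrite mem_filter => /andP[->].
  by move=> q /negPf ->; rewrite mulr0.
rewrite big1_seq.
  move: pout; rewrite mem_filter negb_and; case: (R p) => //= pout.
  by rewrite pcoef_out.
move=> q /andP[_ qin]; case: eqP => [qp|]; rewrite ?mulr0 //.
by rewrite -qp qin in pout.
Qed.

Definition restrict (R : pred (qpath Q)) x : KQ :=
  \sum_(q <- psupp x | R q) pcoef x q *: pelt K q.

Lemma pcoef_restrict R x p : pcoef (restrict R x) p = if R p then pcoef x p else 0.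
Proof. exact: sum_pelt. Qed.

Definition supp_in P : set KQ := [set x | forall p, p \in psupp x -> P p].

Lemma supp_in0 P : supp_in P 0.
Proof. by move=> p; rewrite psuppP pcoef0 eqxx. Qed.

Lemma supp_inD P x y : supp_in P x -> supp_in P y -> supp_in P (x + y).
Proof.
move=> xP yP p; rewrite psuppP pcoefD.
case: (boolP (p \in psupp x)) => [/xP//|/pcoef_out ->].
by rewrite add0r -psuppP => /yP.
Qed.

Lemma supp_inZ P c x : supp_in P x -> supp_in P (c *: x).
Proof.
move=> xP p; rewrite psuppP pcoefZ mulf_eq0 negb_or => /andP[_].
by rewrite -psuppP => /xP.
Qed.

Lemma supp_inB P x y : supp_in P x -> supp_in P y -> supp_in P (x - y).
Proof. by move=> xP yP; rewrite -scaleN1r; apply: supp_inD => //; apply: supp_inZ. Qed.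

Lemma supp_in_sum P (J : eqType) (s : seq J) (R : pred J) (F : J -> KQ) :
  (forall i, i \in s -> R i -> supp_in P (F i)) ->
  supp_in P (\sum_(i <- s | R i) F i).
Proof.
move=> FP; rewrite big_seq_cond.
apply: (big_ind (supp_in P)) => [|x y|i /andP[]];
  [exact: supp_in0|exact: supp_inD|exact: FP].
Qed.

Lemma supp_in_pelt P p : P p -> supp_in P (pelt K p).
Proof. by move=> Pp q; rewrite psupp_pelt in_fset1 => /eqP ->. Qed.

Lemma supp_in_sub P P' : P `<=` P' -> supp_in P `<=` supp_in P'.
Proof. by move=> sPP' x xP p /xP /sPP'. Qed.

Lemma sandwich_pelt a q b :
  pelt K a * pelt K q * pelt K b = if pcat3 a q b is Some p then pelt K p else 0.
Proof.
rewrite pelt_mul /pcat3; case: (pcat a q) => [r|] /=; last by rewrite mul0r.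
by rewrite pelt_mul.
Qed.

Lemma sandwichE a x b :
  pelt K a * x * pelt K b =
  \sum_(q <- psupp x) pcoef x q *: (if pcat3 a q b is Some p then pelt K p else 0).
Proof.
rewrite {1}(kqE x) mulr_sumr mulr_suml; apply: eq_bigr => q _.
by rewrite -kq_scalerAr -kq_scalerAl sandwich_pelt.
Qed.

(** Paths are cancellative ([pcat3_inj]), so at most one term of [x] contributes
    to a given coefficient of [a x b]. *)
Lemma pcoef_sandwich a x b p q :
  pcat3 a q b = Some p -> pcoef (pelt K a * x * pelt K b) p = pcoef x q.
Proof.
move=> qp; transitivity (pcoef (\sum_(r <- psupp x) pcoef x r *: pelt K r) q).
  rewrite sandwichE !pcoef_sum; apply: eq_bigr => r _; rewrite !pcoefZ pcoef_pelt.
  congr (_ * _); case: eqP => [->|ne]; first by rewrite qp pcoef_pelt eqxx.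
  case rs: (pcat3 a r b) => [s|]; last exact: pcoef0.
  rewrite pcoef_pelt; case: eqP => // sp; case: ne.
  by apply: (pcat3_inj _ qp); rewrite -sp.
by rewrite -kqE.
Qed.

Lemma psupp_sandwich a x b p :
  p \in psupp (pelt K a * x * pelt K b) ->
  exists2 q, q \in psupp x & pcat3 a q b = Some p.
Proof.
move=> pin; apply: contrapT => nex; move: pin.
rewrite psuppP sandwichE pcoef_sum big1_seq ?eqxx // => q /andP[_ qx].
rewrite pcoefZ; case qr: (pcat3 a q b) => [r|]; last by rewrite pcoef0 mulr0.
rewrite pcoef_pelt; case: eqP => [rp|]; last by rewrite mulr0.
by case: nex; exists q; rewrite // -rp.
Qed.

(** Selecting terms after multiplication amounts to selecting, before it, the
    terms whose product is selected. *)
Lemma restrict_sandwich R a x b :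
  restrict R (pelt K a * x * pelt K b) =
  pelt K a * restrict [pred q | oapp R false (pcat3 a q b)] x * pelt K b.
Proof.
apply: kq_eqP => p; rewrite pcoef_restrict.
have [[q qp]|nex] := pselect (exists q, pcat3 a q b = Some p).
  by rewrite !(pcoef_sandwich _ qp) pcoef_restrict /= qp.
by rewrite !pcoef_out ?if_same //; apply/negP => /psupp_sandwich[q _ qp];
  apply: nex; exists q.
Qed.

End Coefficients.

(** * Ideals and multihomogeneous components *)

Section Ideals.
Context (K : fieldType) (Q : quiver).
Local Notation KQ := (path_algebra K Q).
Implicit Types (x y : KQ) (I J S : set KQ).

Lemma pelt_neq0 p : pelt K p != 0 :> KQ.
Proof.
apply/eqP => /(congr1 (fun x => pcoef x p)) /eqP.
by rewrite pcoef_pelt eqxx pcoef0 oner_eq0.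
Qed.

(** The path algebra is spanned by paths and its unit is the sum of the vertices,
    so one-sided products are combinations of two-sided products by paths. *)
Lemma ideal_of_sandwich I :
    I 0 -> (forall x y, I x -> I y -> I (x + y)) ->
    (forall c x, I x -> I (c *: x)) ->
    (forall a b x, I x -> I (pelt K a * x * pelt K b)) ->
  two_sided_ideal I.
Proof.
move=> I0 ID IZ IM.
have Isum (J : Type) (s : seq J) (F : J -> KQ) :
    (forall i, I (F i)) -> I (\sum_(i <- s) F i).
  by move=> IF; apply: (big_ind I).
have one_sum : 1 = \sum_v pelt K (trivial_path v) :> KQ by [].
split=> // a x Ix.
  have -> : x = \sum_v x * pelt K (trivial_path v).
    by rewrite -mulr_sumr -one_sum mulr1.
  rewrite (kqE a) mulr_suml; apply: (Isum) => p.
  rewrite mulr_sumr; apply: (Isum) => v.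
  by rewrite mulrA -!kq_scalerAl; apply/IZ/IM.
have -> : x = \sum_v pelt K (trivial_path v) * x.
  by rewrite -mulr_suml -one_sum mul1r.
rewrite (kqE a) mulr_sumr; apply: (Isum) => p.
rewrite mulr_suml; apply: (Isum) => v.
by rewrite -kq_scalerAr; apply/IZ/IM.
Qed.

Section IdealOperations.
Context (I : set KQ) (idI : two_sided_ideal I).

Lemma ideal0 : I 0. Proof. by case: idI. Qed.

Lemma idealD x y : I x -> I y -> I (x + y).
Proof. by case: idI => _ ID _ _; apply: ID. Qed.

Lemma idealZ c x : I x -> I (c *: x).
Proof.
by case: idI => _ _ IM _ Ix; rewrite -[x]mul1r kq_scalerAl; apply: IM.
Qed.

Lemma idealB x y : I x -> I y -> I (x - y).
Proof. by move=> Ix Iy; rewrite -scaleN1r; apply: idealD => //; apply: idealZ. Qed.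

Lemma ideal_sandwich a b x : I x -> I (a * x * b).
Proof. by case: idI => _ _ IMl IMr Ix; apply/IMr/IMl. Qed.

Lemma ideal_sum (J : eqType) (s : seq J) (R : pred J) (F : J -> KQ) :
  (forall i, i \in s -> R i -> I (F i)) -> I (\sum_(i <- s | R i) F i).
Proof.
move=> IF; rewrite big_seq_cond; apply: (big_ind I).
- exact: ideal0.
- exact: idealD.
- by move=> i /andP[]; apply: IF.
Qed.

End IdealOperations.

Lemma ideal_gen_ideal S : two_sided_ideal (ideal_gen S).
Proof.
split=> [J [idJ _]|x y Sx Sy J [idJ SJ]|a x Sx J [idJ SJ]|a x Sx J [idJ SJ]].
- exact: ideal0.
- by apply: idealD => //; [apply: Sx|apply: Sy].
- by case: (idJ) => _ _ IM _; apply: IM; apply: Sx.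
- by case: (idJ) => _ _ _ IM; apply: IM; apply: Sx.
Qed.

Lemma ideal_gen_gen S : S `<=` ideal_gen S.
Proof. exact: sub_gen_smallest. Qed.

Lemma ideal_gen_sub S I : two_sided_ideal I -> S `<=` I -> ideal_gen S `<=` I.
Proof. exact: smallest_sub. Qed.

(** A monomial ideal is spanned by the paths that it contains. *)
Lemma path_idealE (P : set (qpath Q)) :
  path_ideal K P = supp_in (K := K) (extensions P).
Proof.
apply/seteqP; split.
  apply: ideal_gen_sub => [|_ [p Pp <-]]; last first.
    by apply: supp_in_pelt; apply: sub_extensions.
  apply: ideal_of_sandwich; [exact: supp_in0|exact: supp_inD|exact: supp_inZ|].
  by move=> a b x xP p /psupp_sandwich[q /xP qP qp]; exact: pcat3_extensions qP qp.
have idP : two_sided_ideal (path_ideal K P) by exact: ideal_gen_ideal.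
move=> x xP; rewrite (kqE x); apply: (ideal_sum idP).
move=> p /xP[q [a [b [Pq qp]]]] _; apply: (idealZ idP).
have -> : pelt K p = pelt K a * pelt K q * pelt K b by rewrite sandwich_pelt qp.
apply: (ideal_sandwich idP).
by apply: ideal_gen_gen; exists q.
Qed.

Lemma path_ideal_pelt (P : set (qpath Q)) p : path_ideal K P (pelt K p) <-> extensions P p.
Proof.
rewrite path_idealE; split=> [|Pp]; last exact: supp_in_pelt.
by apply; rewrite psupp_pelt in_fset1.
Qed.

(** An ideal that contains, with each element, all sums of its multihomogeneous
    components.  Selecting an arbitrary union of multidegrees, rather than a
    single one, makes the condition stable under [restrict_sandwich]. *)
Definition multigraded I :=
  forall R : pred (qpath Q), (forall p q, parallel p q -> R p = R q) ->
    forall x, I x -> I (restrict R x).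

Lemma homogeneous_uniform_parallel x p q :
  uniform x -> length_homogeneous x ->
  p \in psupp x -> q \in psupp x -> parallel p q.
Proof.
move=> [_ [v [w ex]]] [d xd] px qx.
have ends r : r \in psupp x -> psrc r = v /\ ptgt r = w.
  rewrite {1}ex => /psupp_sandwich[s _ rs].
  by rewrite (pcat3_tgt rs); case/pcat3P: rs.
have [sp tp] := ends p px; have [sq tq] := ends q qx.
by split; rewrite ?(xd _ px) ?(xd _ qx) ?sp ?sq ?tp ?tq.
Qed.

(** The elements whose components all lie in the ideal form an ideal, and a
    uniform length homogeneous generator is a single component. *)
Lemma ideal_gen_multigraded S :
  S `<=` @uniform K Q `&` @length_homogeneous K Q -> multigraded (ideal_gen S).
Proof.
move=> Shom R Rpar x Sx; move: x Sx R Rpar.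
pose J := [set x : KQ | forall R, (forall p q, parallel p q -> R p = R q) ->
  ideal_gen S (restrict R x)].
have idS := ideal_gen_ideal S.
suff: ideal_gen S `<=` J by [].
apply: ideal_gen_sub => [|x Sx R Rpar].
  apply: ideal_of_sandwich => [R _|x y Jx Jy R Rpar|c x Jx R Rpar|a b x Jx R Rpar].
  - rewrite (_ : restrict R 0 = 0); first exact: (ideal0 idS).
    by apply: kq_eqP => p; rewrite pcoef_restrict pcoef0 if_same.
  - rewrite (_ : restrict R _ = restrict R x + restrict R y).
      by apply: (idealD idS); [exact: Jx R Rpar|exact: Jy R Rpar].
    apply: kq_eqP => p; rewrite pcoefD !pcoef_restrict pcoefD.
    by case: (R p); rewrite ?addr0.
  - rewrite (_ : restrict R _ = c *: restrict R x).
      by apply: (idealZ idS); exact: Jx R Rpar.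
    apply: kq_eqP => p; rewrite pcoefZ !pcoef_restrict pcoefZ.
    by case: (R p); rewrite ?mulr0.
  - rewrite restrict_sandwich; apply: (ideal_sandwich idS).
    apply: (Jx [pred q | oapp R false (pcat3 a q b)]) => p q pq /=.
    case pr: (pcat3 a p b) => [r|] /=.
      have [s -> rs] := pcat3_parallel pq pr; exact: Rpar.
    case qr: (pcat3 a q b) => [r|] //=.
    by have [s] := pcat3_parallel (parallel_sym pq) qr; rewrite pr.
have [xu xh] := Shom x Sx.
have [[p px Rp]|nR] := pselect (exists2 p, p \in psupp x & R p).
  rewrite (_ : restrict R x = x); first exact: ideal_gen_gen.
  apply: kq_eqP => q; rewrite pcoef_restrict.
  case: (boolP (q \in psupp x)) => [qx|/pcoef_out ->]; last by rewrite if_same.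
  by rewrite -(Rpar _ _ (homogeneous_uniform_parallel xu xh px qx)) Rp.
rewrite (_ : restrict R x = 0); first exact: (ideal0 idS).
apply: kq_eqP => q; rewrite pcoef_restrict pcoef0.
case: ifP => // Rq; apply: pcoef_out; apply/negP => qx.
by apply: nR; exists q.
Qed.

End Ideals.

(** * Tips and normal forms *)

Section Tips.
Context (K : fieldType) (Q : quiver) (le : rel (qpath Q)).
Context (le_adm : length_admissible le).
Local Notation KQ := (path_algebra K Q).
Implicit Types (x y n : KQ) (I J : set KQ) (a b p q r : qpath Q).

Lemma exists_tip x : x != 0 -> exists p, is_tip le x p.
Proof.
move=> x0; have [p px] : exists p, p \in psupp x.
  apply: contrapT => nex; case/eqP: x0; apply: kq_eqP => p.
  rewrite pcoef0; apply: pcoef_out; apply/negP => px.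
  by apply: nex; exists p.
by have [q qx qmax] := le_max le_adm px; exists q.
Qed.

Lemma tip_neq0 x p : is_tip le x p -> x != 0.
Proof. by case=> px _; apply: contraTneq px => ->; rewrite psuppP pcoef0 eqxx. Qed.

Lemma is_tip_pelt p : is_tip le (pelt K p) p.
Proof.
split=> [|q]; rewrite psupp_pelt in_fset1 ?eqxx // => /eqP ->.
exact: le_refl.
Qed.

Lemma is_tip_sandwich a b x p r :
  pcat3 a p b = Some r -> is_tip le x p ->
  is_tip le (pelt K a * x * pelt K b) r.
Proof.
move=> pr [px pmax]; split; first by rewrite psuppP (pcoef_sandwich _ pr) -psuppP.
move=> s /psupp_sandwich[q qx qs].
have [qp|nqp] := eqVneq q p.
  by move: qs; rewrite qp pr => -[<-]; apply: le_refl.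
apply: path_gt_le; apply: (pcat3_gt le_adm pr qs).
by rewrite /path_gt nqp pmax.
Qed.

Lemma tips_extensions I :
  two_sided_ideal I -> extensions (tips le I) `<=` tips le I.
Proof.
move=> idI r [p [a [b [[x [Ix x0 xp]] pr]]]].
have yr := is_tip_sandwich pr xp.
exists (pelt K a * x * pelt K b); split=> //; last exact: tip_neq0 yr.
exact: ideal_sandwich.
Qed.

(** The support of an element of a monomial ideal lies in the ideal, whatever
    the order; so does its tip. *)
Lemma tips_path_ideal P : tips le (path_ideal K P) = extensions P.
Proof.
apply/seteqP; split=> p.
  by case=> x []; rewrite path_idealE => xP _ [/xP].
move=> Pp; exists (pelt K p); split; first exact/path_ideal_pelt.
  exact: pelt_neq0.
exact: is_tip_pelt.
Qed.

Lemma ideal_nontips0 I x : I x -> supp_in (nontips le I) x -> x = 0.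
Proof.
move=> Ix xN; apply: contrapT => /eqP x0; have [p [px pmax]] := exists_tip x0.
by apply: (xN p px); exists x.
Qed.

(** The division algorithm, by induction on [p].  If [p] is the tip of an element
    of [I], the component of that element in the multidegree of [p] has the same
    tip, and rewrites [p] into smaller parallel paths. *)
Lemma exists_normal_form I :
    two_sided_ideal I -> multigraded I ->
  forall p, exists n, [/\ supp_in (nontips le I) n,
    supp_in [set q | parallel p q /\ le q p] n & I (pelt K p - n)].
Proof.
move=> idI mI; apply: (path_gt_ind le_adm) => p ih.
have [[x [Ix x0 [px pmax]]]|nt] := pselect (tips le I p); last first.
  exists (pelt K p); split; first exact: supp_in_pelt.
    by apply: supp_in_pelt; split; [exact: parallel_refl|exact: le_refl].
  by rewrite subrr; apply: (ideal0 idI).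
(* The component of [x] of the multidegree of [p]. *)
pose y := restrict [pred q | `[< parallel p q >]] x.
have yE q : q \in psupp y -> parallel p q /\ le q p.
  rewrite psuppP pcoef_restrict /=; case: asboolP => [pq|_]; last by rewrite eqxx.
  by rewrite -psuppP => /pmax.
have Iy : I y.
  apply: mI => // q r qr /=; apply/asbool_equiv_eq; split=> h.
    exact: parallel_trans h qr.
  exact: parallel_trans h (parallel_sym qr).
have yp0 : pcoef y p != 0.
  rewrite pcoef_restrict /=; case: asboolP => [_|[]//].
  by rewrite -psuppP.
have {}ih q : exists n, q \in psupp y -> q != p ->
  [/\ supp_in (nontips le I) n,
    supp_in [set q' | parallel q q' /\ le q' q] n & I (pelt K q - n)].
  have [/andP[qy qp]|nq] := boolP ((q \in psupp y) && (q != p)); last first.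
    by exists 0 => qy qp; rewrite qy qp in nq.
  have [|n nP] := ih q; last by exists n.
  by rewrite /path_gt qp; case: (yE q qy).
have [nf nfP] := choice ih.
pose n := \sum_(q <- psupp y | q != p) pcoef y q *: nf q.
exists (- (pcoef y p)^-1 *: n); split.
- by apply: supp_inZ; apply: supp_in_sum => q qy qp; apply: supp_inZ; case: (nfP q).
- apply: supp_inZ; apply: supp_in_sum => q qy qp; apply: supp_inZ.
  have [_ nq _] := nfP q qy qp; apply: supp_in_sub nq => r [qr rq].
  have [pq qp'] := yE q qy; split; first exact: parallel_trans pq qr.
  exact: (le_trans le_adm rq qp').
have -> : pelt K p - - (pcoef y p)^-1 *: n = (pcoef y p)^-1 *: (pcoef y p *: pelt K p + n).
  by rewrite scalerDr scalerA mulVf // scale1r scaleNr opprK.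
apply: (idealZ idI).
have -> : pcoef y p *: pelt K p + n =
    y - \sum_(q <- psupp y | q != p) pcoef y q *: (pelt K q - nf q).
  have := kqE y; rewrite (bigD1_seq p) ?fset_uniq ?psuppP //=.
  move/eqP; rewrite -subr_eq => /eqP <-.
  under [in RHS]eq_bigr do rewrite scalerBr.
  by rewrite sumrB opprB addrAC addrA.
apply: (idealB idI) => //; apply: (ideal_sum idI) => q qy qp.
by apply: (idealZ idI); case: (nfP q).
Qed.

Lemma exists_nontip_rep I x :
    two_sided_ideal I -> multigraded I ->
  exists2 n, supp_in (nontips le I) n & I (x - n).
Proof.
move=> idI mI; have [nf nfP] := choice (exists_normal_form idI mI).
exists (\sum_(p <- psupp x) pcoef x p *: nf p).
  by apply: supp_in_sum => p _ _; apply: supp_inZ; case: (nfP p).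
rewrite {1}(kqE x) -sumrB; apply: (ideal_sum idI) => p _ _.
by rewrite -scalerBr; apply: (idealZ idI); case: (nfP p).
Qed.

(** The normal form of an element of [I] modulo [J] lies in [I] and has no tip
    of [J], hence none of [I], in its support: it is zero. *)
Lemma ideal_eq_tips I J :
    two_sided_ideal I -> two_sided_ideal J -> multigraded J ->
    J `<=` I -> tips le I `<=` tips le J -> I = J.
Proof.
move=> idI idJ mJ sJI sIJ; apply/seteqP; split=> // x Ix.
have [n nN Jn] := exists_nontip_rep x idJ mJ.
have In : I n by rewrite -(subKr x n); apply: (idealB idI) => //; apply: sJI.
have n0 : n = 0.
  apply: (ideal_nontips0 In); apply: supp_in_sub nN => p nJ Ip.
  exact/nJ/sIJ.
by rewrite n0 subr0 in Jn.
Qed.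

Lemma lin_span_pelt (P : set (qpath Q)) : lin_span (pelt K @` P) = supp_in (K := K) P.
Proof.
apply/seteqP; split=> [x [s [c [sP ->]]]|x xP].
  apply: supp_in_sum => b /sP[p Pp <-] _; apply: supp_inZ; exact: supp_in_pelt.
exists [seq pelt K p | p <- psupp x].
(* The coefficient at [z] is the scalar product of [x] and [z], which avoids an
   inverse of [pelt]. *)
exists (fun z => \sum_(p <- psupp x) pcoef x p * pcoef z p); split.
  by move=> _ /mapP[p /xP Pp ->]; exists p.
rewrite big_map {1}(kqE x); apply: eq_big_seq => p px; congr (_ *: _).
rewrite (bigD1_seq p) ?fset_uniq //= pcoef_pelt eqxx mulr1 big1 ?addr0 //.
by move=> q; rewrite pcoef_pelt eq_sym => /negPf ->; rewrite mulr0.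
Qed.

Lemma lin_indep_pelt (P : set (qpath Q)) : lin_indep (pelt K @` P).
Proof.
move=> s c us sP s0 x xs; have [p Pp xp] := sP x xs.
have := congr1 (fun y => pcoef y p) s0; rewrite /= pcoef0 pcoef_sum => <-.
rewrite (bigD1_seq x) //= pcoefZ -xp pcoef_pelt eqxx mulr1 big1_seq ?addr0 //.
move=> y /andP[yx /sP[q _ yq]]; rewrite pcoefZ -yq pcoef_pelt.
case: eqP => [qp|]; last by rewrite mulr0.
by case/eqP: yx; rewrite -yq qp.
Qed.

(** A coset contains a combination of nontips by the division algorithm, and
    only one since the tip of the difference of two would be both a tip and a
    nontip of [I]. *)
Lemma quotient_in_KQE I :
  two_sided_ideal I -> multigraded I -> quotient_in_KQ le I = supp_in (nontips le I).
Proof.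
move=> idI mI; have spanE : nontip_span le I = supp_in (nontips le I) :=
  lin_span_pelt _.
rewrite /quotient_in_KQ /normal_rep spanE; apply/seteqP; split=> [_ [_ [x _ <-] <-]|n nN].
  have [n nN In] := exists_nontip_rep x idI mI.
  case: xgetP => [y -> []//|/(_ n)[]]; split=> //.
  by rewrite /ideal_coset /= -opprB -scaleN1r; apply: (idealZ idI).
exists (ideal_coset I n); first by exists n.
case: xgetP => [y _ [Iy yN]|/(_ n)[]]; last first.
  by split=> //; rewrite /ideal_coset /= subrr; apply: (ideal0 idI).
apply/eqP; rewrite -subr_eq0; apply/eqP; apply: (ideal_nontips0 (Iy : I (y - n))).
exact: supp_inB.
Qed.

End Tips.

(** * The ideals of the family *)

Section GrAlgFamily.
Context (K : fieldType) (Q : quiver) (le : rel (qpath Q)).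
Context (le_adm : length_admissible le) (T : {set path2 Q}).
Local Notation KQ := (path_algebra K Q).
Implicit Types (X : affine_space K le T) (t : path2 Q) (x y : KQ) (p q : qpath Q).

Lemma plen_path2 t : plen (val t) = 2.
Proof. exact/eqP/(valP t). Qed.

Lemma N_pathsE : N_paths K le T = ~` extensions (T_paths T).
Proof. by rewrite /N_paths tips_path_ideal. Qed.

Lemma N_paths_notin t : t \in T -> ~ N_paths K le T (val t).
Proof. by move=> tT; rewrite N_pathsE; apply; apply: sub_extensions; exists t. Qed.

Lemma coordinateP (c : coordinate K le T) :
  [/\ (val c).1 \in T, N_paths K le T (val (val c).2),
      path_gt le (val (val c).1) (val (val c).2)
    & parallel (val (val c).1) (val (val c).2)].
Proof.
case/andP: (valP c) => tT; rewrite !inE => /andP[/asboolP nN].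
case/and3P => gt /eqP es /eqP et; split=> //.
by split; rewrite ?plen_path2.
Qed.

Lemma pcoef_g_of X t p :
  pcoef (g_of X t) p =
  (val t == p)%:R - \sum_(c | (val c).1 == t) X c * (val (val c).2 == p)%:R.
Proof.
rewrite pcoefD pcoefN pcoef_pelt pcoef_sum; congr (_ - _).
by apply: eq_bigr => c _; rewrite pcoefZ pcoef_pelt.
Qed.

Lemma g_support X t p :
  p \in psupp (g_of X t) ->
  p = val t \/ [/\ N_paths K le T p, path_gt le (val t) p & parallel (val t) p].
Proof.
move=> pg; apply: contrapT => /not_orP[npt nN]; move: pg.
rewrite psuppP pcoef_g_of; case: (val t =P p) => [tp|_]; first by case: npt; rewrite tp.
rewrite big1 ?subr0 ?eqxx // => c /eqP ct; case: eqP => [cp|]; last by rewrite mulr0.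
by case: nN; rewrite -ct -cp; have [] := coordinateP c.
Qed.

Lemma g_parallel X t p :
  p \in psupp (g_of X t) -> parallel (val t) p /\ le p (val t).
Proof.
case/g_support => [->|[_ gt par]]; last by split=> //; apply: path_gt_le.
by split; [apply: parallel_refl|apply: le_refl].
Qed.

(** The paths of [N_2] have no subpath in [T], so [T] meets the support of [g_t]
    in [t] alone. *)
Lemma g_coef_T X t t' : t \in T -> pcoef (g_of X t') (val t) = (t' == t)%:R.
Proof.
move=> tT; rewrite pcoef_g_of big1 ?subr0 // => c _; case: eqP => [ct|]; last by rewrite mulr0.
have [_ cN _ _] := coordinateP c.
by case: (N_paths_notin tT); rewrite -ct.
Qed.

Lemma g_tip X t : t \in T -> is_tip le (g_of X t) (val t).
Proof.
move=> tT; split; first by rewrite psuppP g_coef_T // eqxx oner_eq0.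
by move=> q /g_parallel[].
Qed.

Lemma G_homogeneous X :
  G_of X `<=` @uniform K Q `&` @length_homogeneous K Q.
Proof.
move=> _ [t tT <-]; have tip := g_tip X tT; split; last first.
  by exists 2 => p /g_parallel[[<- _ _] _]; apply: plen_path2.
split; first exact: tip_neq0 tip.
exists (psrc (val t)), (ptgt (val t)); apply: kq_eqP => p.
have [pg|npg] := boolP (p \in psupp (g_of X t)).
  have [[_ es et] _] := g_parallel pg.
  by rewrite es et (pcoef_sandwich _ (pcat3_id p)).
rewrite !pcoef_out //; apply: contra npg => /psupp_sandwich[q qg].
by case/pcat3P=> _ _ es ea; rewrite (_ : p = q) //; have [[_ e _] _] := g_parallel qg;
  apply: qpath_inj; rewrite ?es ?ea //= cats0.
Qed.

Lemma G_multigraded X : multigraded (ideal_gen (G_of X)).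
Proof. exact: ideal_gen_multigraded (@G_homogeneous X). Qed.

Lemma T_paths_tips X : T_paths T `<=` tips le (ideal_gen (G_of X)).
Proof.
move=> _ [t tT <-]; have tip := g_tip X tT.
exists (g_of X t); split; [|exact: tip_neq0 tip|exact: tip].
by apply: ideal_gen_gen; exists t.
Qed.

(** The elements with terms of length at least 2 only, and whose part of length 2
    is a combination of the [g_t]; by [g_coef_T] the coefficient of [g_t] can
    only be that of [t].  Written as linear equations on coefficients. *)
Definition quad_rel X : set KQ :=
  [set x | supp_in [set p | (2 <= plen p)%N] x /\
    forall p, plen p = 2 ->
      pcoef x p = \sum_(t in T) pcoef x (val t) * pcoef (g_of X t) p].

(** In lowest degree a product by two paths acts on each multidegree as a scalar:
    1 when both paths are the end vertices of that multidegree, 0 otherwise. *)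
Lemma sandwich_quadratic x a b p :
    supp_in [set p | (2 <= plen p)%N] x -> plen p = 2 ->
  exists e : K, forall q, parallel p q ->
    pcoef (pelt K a * x * pelt K b) q = e * pcoef x q.
Proof.
move=> x2 p2.
have [[a0 b0 es et]|nC] := pselect
  [/\ plen a = 0%N, plen b = 0%N, ptgt a = psrc p & ptgt p = psrc b].
  exists 1 => q [_ qs qt]; rewrite mul1r; apply: pcoef_sandwich; apply/pcat3P.
  rewrite /ptgt /plen in a0 b0 es *.
  move/size0nil: a0 es => a0; rewrite a0 (size0nil b0) /= cats0.
  by rewrite -/(ptgt q) -qt et -qs => ->.
exists 0 => q [ql qs qt]; rewrite mul0r; apply: pcoef_out.
apply/negP=> /psupp_sandwich[r /x2 /= r2 rq]; apply: nC.
have := pcat3_len rq; rewrite -ql p2 => e2.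
have a0 : plen a = 0%N by lia.
have b0 : plen b = 0%N by lia.
have /pcat3P[e1 _ e3 _] := rq; split=> //.
  by rewrite qs e3 /ptgt (size0nil a0).
by rewrite qt (pcat3_tgt rq) /ptgt (size0nil b0).
Qed.

Lemma quad_rel_ideal X : two_sided_ideal (quad_rel X).
Proof.
apply: ideal_of_sandwich => [|x y [x2 xE] [y2 yE]|c x [x2 xE]|a b x [x2 xE]].
- split; first exact: supp_in0.
  by move=> p _; rewrite big1 ?pcoef0 // => t _; rewrite pcoef0 mul0r.
- split; first exact: supp_inD.
  move=> p p2; rewrite pcoefD xE // yE // -big_split /=.
  by apply: eq_bigr => t _; rewrite pcoefD mulrDl.
- split; first exact: supp_inZ.
  move=> p p2; rewrite pcoefZ xE // mulr_sumr.
  by apply: eq_bigr => t _; rewrite pcoefZ mulrA.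
split=> [p /psupp_sandwich[q /x2 /= q2 /pcat3_len ->]|p p2]; first by lia.
have [e eP] := sandwich_quadratic a b x2 p2.
rewrite (eP p (parallel_refl p)) xE // mulr_sumr; apply: eq_bigr => t _.
have [pg|/pcoef_out ->] := boolP (p \in psupp (g_of X t)); last by rewrite !mulr0.
by rewrite eP ?mulrA //; apply: parallel_sym; have [] := g_parallel pg.
Qed.

Lemma ideal_gen_G_quad_rel X : ideal_gen (G_of X) `<=` quad_rel X.
Proof.
apply: ideal_gen_sub; first exact: quad_rel_ideal.
move=> _ [t tT <-]; split=> [p /g_parallel[[pl _ _] _] /=|p _].
  by rewrite -pl plen_path2.
rewrite (bigD1 t) //= g_coef_T // eqxx mul1r big1 ?addr0 // => t' /andP[t'T t't].
by rewrite g_coef_T // eq_sym (negPf t't) mul0r.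
Qed.

(** The coefficient of [p] in the combination of the [g_t] is nonzero, so [p]
    occurs in some [g_t], whence [p <= t], with [t] in the support of [x], whence
    [t <= p]. *)
Lemma quadratic_tip_in_T X x p :
  ideal_gen (G_of X) x -> is_tip le x p -> plen p = 2 -> T_paths T p.
Proof.
move=> /ideal_gen_G_quad_rel[_ xE] [px pmax] p2.
have [t tT] : exists2 t, t \in T & pcoef x (val t) * pcoef (g_of X t) p != 0.
  apply: contrapT => nex; move: px; rewrite psuppP xE // big1 ?eqxx // => t tT.
  by apply: contrapT => /eqP ne; apply: nex; exists t.
rewrite mulf_eq0 negb_or -!psuppP => /andP[/pmax tp /g_parallel[_ pt]].
by exists t => //; apply: (le_anti le_adm).
Qed.

(** The tips of a Groebner basis determine all tips, and those of a quadratic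
    one are in [T]. *)
Lemma GrAlg_tips X :
  GrAlg X -> tips le (ideal_gen (G_of X)) = extensions (T_paths T).
Proof.
set I := ideal_gen _ => -[G [_ GI _ Gtips] Gquad].
have idI : two_sided_ideal I by exact: ideal_gen_ideal.
apply/seteqP; split=> p; last first.
  move=> Tp; apply: (tips_extensions le_adm idI).
  exact: extensions_sub (@T_paths_tips X) _ Tp.
move=> /sub_extensions /(path_ideal_pelt K).
rewrite -/I -Gtips => /path_ideal_pelt; apply: extensions_sub => q [x [Gx _ xq]].
by apply: (quadratic_tip_in_T (GI x Gx) xq); apply: (Gquad x Gx); case: xq.
Qed.

(** * Recovering the coordinates from the tips *)

Section NontipsToFamily.
Context (I : set KQ) (idI : two_sided_ideal I) (mI : multigraded I).
Context (NI : N_paths K le T = nontips le I).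

Lemma tips_extensions_T : tips le I = extensions (T_paths T).
Proof. by apply: classical_sets.setC_inj; rewrite -N_pathsE NI. Qed.

(** The coordinates of the point are the coefficients of the normal forms of the
    paths in [T], which only involve smaller parallel nontips. *)
Lemma exists_G_sub : exists X, G_of X `<=` I.
Proof.
have [nf nfP] := choice (exists_normal_form le_adm idI mI).
pose X : affine_space K le T :=
  [ffun c : coordinate K le T => pcoef (nf (val (val c).1)) (val (val c).2)].
exists X => _ [t tT <-]; have [nN nle It] := nfP (val t).
rewrite (_ : g_of X t = pelt K (val t) - nf (val t)) //; congr (_ - _).
apply: kq_eqP => p; rewrite pcoef_sum.
under eq_bigr do rewrite pcoefZ pcoef_pelt.
have [pn|pn] := boolP (p \in psupp (nf (val t))); last first.
  rewrite pcoef_out // big1 // => c /eqP ct; case: eqP => [cp|]; last by rewrite mulr0.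
  by rewrite ffunE ct cp pcoef_out ?mul0r.
have [[pl ps pt] ple] := nle p pn.
have p2 : plen p == 2 by rewrite -pl plen_path2.
pose n2 : path2 Q := exist _ p p2.
have pN : N_paths K le T p by rewrite NI; apply: nN.
have pt' : p != val t.
  by apply: contraTneq isT => pt0; case: (N_paths_notin tT); rewrite -pt0.
have cP : ((t, n2).1 \in T) && ((t, n2).2 \in N2_of K le T (t, n2).1).
  rewrite tT !inE /path_gt /= pt' ple ps pt !eqxx !andbT.
  exact/asboolP.
pose c0 : coordinate K le T := exist _ (t, n2) cP.
rewrite (bigD1 c0) //= eqxx mulr1 big1 ?addr0; first by rewrite ffunE.
move=> c /andP[/eqP ct cc0]; case: eqP => [cp|]; last by rewrite mulr0.
case/eqP: cc0; apply: val_inj; rewrite [val c]surjective_pairing ct /=.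
by congr pair; apply: val_inj.
Qed.

Lemma nontips_in_GrAlg : in_GrAlg le T I.
Proof.
have [X GI] := exists_G_sub.
have idG : two_sided_ideal (ideal_gen (G_of X)) by exact: ideal_gen_ideal.
have eI : I = ideal_gen (G_of X).
  apply: (ideal_eq_tips le_adm idI idG (@G_multigraded X)).
    exact: ideal_gen_sub.
  rewrite tips_extensions_T => p Tp; apply: (tips_extensions le_adm idG).
  exact: extensions_sub (@T_paths_tips X) _ Tp.
exists X => //; exists (G_of X); last first.
  by move=> _ [t tT <-] p /g_parallel[[<- _ _] _]; apply: plen_path2.
have GuH := @G_homogeneous X.
split.
- by exists (G_of X) => // x /GuH[].
- exact: ideal_gen_gen.
- by move=> x /GuH[].
rewrite !path_idealE; congr supp_in; apply/seteqP; split.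
  apply: extensions_sub => p [x [Gx x0 xp]].
  by exists x; split=> //; apply: ideal_gen_gen.
move=> p /(tips_extensions le_adm idG); rewrite -eI tips_extensions_T.
apply: extensions_sub => _ [t tT <-]; have tip := g_tip X tT.
by exists (g_of X t); split; [exists t|exact: tip_neq0 tip|].
Qed.

End NontipsToFamily.
End GrAlgFamily.

Theorem theorem4p4 (K : fieldType) (Q : quiver) (le : rel (qpath Q))
    (le_adm : length_admissible le) (T : {set path2 Q})
    (I : set (path_algebra K Q))
    (I_gen : exists2 S : set (path_algebra K Q),
       S `<=` @uniform K Q `&` @length_homogeneous K Q & I = ideal_gen S) :
  (in_GrAlg le T I <-> N_paths K le T = nontips le I) /\
  (in_GrAlg le T I ->
     is_basis (pelt K @` N_paths K le T) (quotient_in_KQ le I)).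
Proof.
have [idI mI] : two_sided_ideal I /\ multigraded I.
  have [S Shom ->] := I_gen; split; first exact: ideal_gen_ideal.
  exact: ideal_gen_multigraded.
have NI : in_GrAlg le T I -> N_paths K le T = nontips le I.
  by move=> [X GX ->]; rewrite /nontips (GrAlg_tips le_adm GX) N_pathsE.
split; first by split=> [|/(nontips_in_GrAlg le_adm idI mI)].
move=> /NI ->; split; first exact: lin_indep_pelt.
by rewrite quotient_in_KQE // lin_span_pelt.
Qed.
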